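(* Let $n\ge 1$ and let $x_1,\dots,x_n$ be commuting indeterminates. Then $$\sum_{\pi \in \mathfrak{D}_n} (-1)^{\mathrm{inv}(\pi)}\, \mathbf{x}_{\mathrm{EXCi}(\pi)} = (-1)^{n-1} \sum_{j=1}^{n-1} x_{1}x_{2}\cdots x_{j}.$$
   Context: $[n]=\{1,\dots,n\}$; $\mathfrak{S}_n$ is the symmetric group on $[n]$; $\mathfrak{D}_n$ is the set of derangements, i.e. permutations $\pi\in\mathfrak{S}_n$ with $\pi(i)\ne i$ for all $i$. $\mathrm{inv}(\pi)$ is the number of pairs $i<j$ with $\pi(i)>\pi(j)$; $\mathrm{EXCi}(\pi)=\{j\in[n]:\pi(j)>j\}$; $\mathbf{x}_S=\prod_{s\in S}x_s$, with $\mathbf{x}_\emptyset=1$. *)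

(* Defs.v *)
From HB Require Import structures.
From mathcomp Require Import all_boot all_order all_fingroup all_algebra.
From mathcomp Require Import mpoly.

Set Implicit Arguments.
Unset Strict Implicit.
Unset Printing Implicit Defensive.

Import GRing.Theory.

(* The set [n] = {1, ..., n} is represented by 'I_n = {0, ..., n - 1}; the
   element k of [n] is the ordinal of value k - 1, so x_k is 'X_(k - 1). *)

Definition derangements (n : nat) : {set 'S_n} :=
  [set s : 'S_n | [forall i, s i != i]].

Definition num_inversions (n : nat) (s : 'S_n) : nat :=
  #|[set p : 'I_n * 'I_n | (p.1 < p.2)%N && (s p.2 < s p.1)%N]|.

Definition EXCi (n : nat) (s : 'S_n) : {set 'I_n} :=
  [set j : 'I_n | (j < s j)%N].

Definition xmon (R : comNzRingType) (n : nat) (S : {set 'I_n}) : {mpoly R[n]} :=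
  (\prod_(s in S) 'X_s)%R.

(* Main.v *)
(* Sorting by fixed points and excedances, the sum is the determinant of the
   matrix with x_i above the diagonal of row i, 0 on it and 1 below.  This matrix
   is J - T with J all-ones and T upper unitriangular.  If e is the all-ones
   column and T y = e, its determinant is (-1)^n (1 - e^T y), and solving the
   triangular system gives e^T y = 1 + x_1 + x_1 x_2 + ... + x_1...x_(n-1). *)

Require Import Defs.
From mathcomp Require Import all_boot all_order all_fingroup all_algebra.
From mathcomp Require Import mpoly.
From mathcomp Require Import ring.

Import GRing.Theory Num.Theory.

Local Open Scope ring_scope.

Lemma sgr_prod (R : realDomainType) (I : Type) (r : seq I) (P : pred I)
    (F : I -> R) :
  Num.sg (\prod_(i <- r | P i) F i) = \prod_(i <- r | P i) Num.sg (F i).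
Proof. by apply: (big_morph _ (@sgrM R)); apply: sgr1. Qed.

(** The factor of a pair [i < j] is negative exactly at an inversion, and injectivity of [s] keeps
    it from vanishing. *)
Lemma sgr_prod_perm_diff (n : nat) (s : 'S_n) :
  Num.sg (\prod_(i < n) \prod_(j < n | (i < j)%N) ((s j)%:Z - (s i)%:Z)) =
  (-1) ^+ num_inversions s.
Proof.
rewrite pair_big_dep /= sgr_prod /num_inversions cardsE -sum1_card expr_sum.
rewrite big_mkcond [RHS]big_mkcond; apply: eq_bigr => -[i j] _ /=.
rewrite unfold_in /=; case: ltnP => //= ltij.
case: ltngtP => [lts|lts|/ord_inj/perm_inj eqij].
- by apply: ltr0_sg; rewrite subr_lt0 ltz_nat.
- by apply: gtr0_sg; rewrite subr_gt0 ltz_nat.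
- by rewrite eqij ltnn in ltij.
Qed.

(* Both signs are read off the Vandermonde determinant of the values of s. *)
Lemma sign_num_inversions (R : pzRingType) (n : nat) (s : 'S_n) :
  (-1) ^+ num_inversions s = (-1) ^+ s :> R.
Proof.
have E : (-1) ^+ num_inversions s = (-1) ^+ s :> int.
  pose V (t : 'S_n) := Vandermonde n (\row_(i < n) (t i)%:Z).
  have VE (t : 'S_n) : \det (V t) =
      \prod_(i < n) \prod_(j < n | (i < j)%N) ((t j)%:Z - (t i)%:Z).
    rewrite det_Vandermonde; apply: eq_bigr => i _.
    by apply: eq_bigr => j _; rewrite !mxE.
  have sgV t : Num.sg (\det (V t)) = (-1) ^+ num_inversions t.
    by rewrite VE sgr_prod_perm_diff.
  have V_s : V s = col_perm s (V 1%g).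
    by apply/matrixP=> i j; rewrite !mxE perm1.
  have inv1 : num_inversions (1%g : 'S_n) = 0%N.
    apply: eq_card0 => -[i j]; rewrite !inE !perm1 /=.
    by case: ltngtP.
  rewrite -sgV V_s col_permE det_mulmx sgrM sgV inv1 mul1r.
  by rewrite det_perm odd_permV sgrX sgrN1.
(* Since 1 and -1 differ in [int], [E] forces equal parities, and these carry over to any [R], even
   of characteristic 2. *)
rewrite -[LHS]signr_odd; congr (_ ^+ nat_of_bool _).
move: E; rewrite -signr_odd.
by case: (odd _); case: (odd_perm s).
Qed.

Lemma det_sub_rank1 (R : comPzRingType) (n : nat) (u : 'cV[R]_n)
    (v : 'rV[R]_n) :
  \det (1%:M - u *m v) = 1 - (v *m u) 0 0.
Proof.
(* Both [L *m M] and [M *m L] are block upper triangular; their equal determinants are the two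
   sides. *)
pose M : 'M_(1 + n) := block_mx 1%:M v u 1%:M.
pose L : 'M_(1 + n) := block_mx 1%:M 0 (- u) 1%:M.
have detL : \det L = 1 by rewrite det_lblock !det1 mulr1.
have LM : \det (L *m M) = \det (1%:M - u *m v).
  rewrite mulmx_block !mul1mx !mul0mx !addr0 mulmx1 mulNmx addNr.
  by rewrite det_ublock det1 mul1r addrC.
have ML : \det (M *m L) = 1 - (v *m u) 0 0.
  rewrite mulmx_block !mul1mx !mulmx0 !mulmx1 subrr add0r.
  by rewrite det_ublock add0r det1 mulr1 det_mx11 mulmxN !mxE.
by rewrite -LM -ML !det_mulmx mulrC.
Qed.

Section ExcedanceMatrix.

Variables (R : comPzRingType) (n : nat) (x : 'I_n -> R).

Definition excedance_mx : 'M[R]_n :=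
  \matrix_(i, j) (if (i < j)%N then x i else (i != j)%:R).

(** In 0-based indices this is 1 + x_m + x_m x_(m+1) + ... for [m < n], and 0 at [m = n]; these are
    the tail sums of the solution y of T y = e. *)
Definition run_sum (m : nat) : R :=
  \sum_(m <= j < n) \prod_(i < n | (m <= i < j)%N) x i.

(** The term [j = i] is an empty product, and all later terms contain [x i]. In terms of tail sums,
    this is row [i] of T y = e. *)
Lemma run_sum_rec (i : 'I_n) : run_sum i = 1 + x i * run_sum i.+1.
Proof.
rewrite /run_sum big_ltn // big1 ?mulr_sumr => [|k]; last by case: ltngtP.
congr (_ + _); apply: eq_big_nat => j /andP[ltij _].
rewrite (bigD1 i) /= ?leqnn //; congr (_ * _); apply: eq_bigl => k.
by rewrite andbAC [in RHS]ltn_neqAle eq_sym [(i <= k)%N && _]andbC.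
Qed.

Lemma sum_run_sum_diff (m : nat) : (m <= n)%N ->
  \sum_(k < n | (m <= k)%N) (run_sum k - run_sum k.+1) = run_sum m.
Proof.
move=> lemn.
rewrite -(big_geq_mkord m n xpredT (fun k => run_sum k - run_sum k.+1)).
rewrite -[LHS]opprK -sumrN; under eq_bigr do rewrite opprB.
by rewrite telescope_sumr // opprB {2}/run_sum big_geq // subr0.
Qed.

Lemma det_excedance_mx : \det excedance_mx = (-1) ^+ n * (1 - run_sum 0).
Proof.
pose T : 'M[R]_n := const_mx 1 - excedance_mx.
pose y : 'cV[R]_n := \col_i (run_sum i - run_sum i.+1).
have TE i j : T i j = if (i < j)%N then 1 - x i else (i == j)%:R.
  rewrite !mxE; case: ltnP => // _.
  by case: eqP; rewrite ?subr0 ?subrr.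
have detT : \det T = 1.
  (* [T] is upper triangular, while [det_trig] expects a lower triangular matrix. *)
  rewrite -det_tr det_trig.
    by apply: big1 => i _; rewrite mxE TE ltnn eqxx.
  apply/is_trig_mxP => i j ltij; rewrite mxE TE ltnNge ltnW //=.
  by rewrite -val_eqE gtn_eqF.
have Ty : T *m y = const_mx 1.
  (* Right of the diagonal, row [i] is constantly [1 - x i] and meets the tail sum of [y]; of the
     rest, only [k = i] survives. *)
  apply/matrixP => i j; rewrite !mxE (bigID (fun k : 'I_n => i < k)%N) /=.
  rewrite (eq_bigr (fun k : 'I_n => (1 - x i) * (run_sum k - run_sum k.+1)));
    last by move=> k ltik; rewrite TE ltik mxE.
  rewrite -mulr_sumr sum_run_sum_diff //.
  rewrite (bigD1 i) ?ltnn //= big1 => [|k /andP[/negPf geik neki]]; last first.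
    by rewrite TE geik eq_sym (negPf neki) mul0r.
  by rewrite TE ltnn eqxx mul1r mxE run_sum_rec; ring.
(* By [Ty], the all-ones matrix is [T *m y *m const_mx 1], so [T] factors out; the scalar -1 yields
   [(-1) ^+ n]. *)
have -> : excedance_mx = -1 *: (T *m (1%:M - y *m const_mx 1)).
  rewrite mulmxBr mulmx1 mulmxA Ty scaleN1r opprB.
  apply/matrixP => i j; rewrite !mxE big_ord1 !mxE; ring.
rewrite detZ det_mulmx detT mul1r det_sub_rank1; congr (_ * (1 - _)).
rewrite mxE -[RHS]sum_run_sum_diff //; apply: eq_bigr => k _.
by rewrite !mxE mul1r.
Qed.

End ExcedanceMatrix.

Lemma det_excedance_mx_derangements (R : comNzRingType) (n : nat) :
  \det (excedance_mx {mpoly R[n]} n (fun i => 'X_i)) =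
  \sum_(s in derangements n) (-1) ^+ num_inversions s * xmon R (EXCi s).
Proof.
(* A fixed point picks a zero diagonal entry, so only derangements contribute to the Leibniz
   expansion. *)
rewrite [LHS](bigID (mem (derangements n))) /= [X in _ + X]big1 ?addr0.
  apply: eq_bigr => s; rewrite inE => /forallP ds.
  rewrite sign_num_inversions; congr (_ * _).
  rewrite /xmon [RHS]big_mkcond; apply: eq_bigr => i _.
  by rewrite mxE inE eq_sym ds.
move=> s; rewrite inE negb_forall => /existsP[i]; rewrite negbK => /eqP si.
by rewrite (bigD1 i) //= mxE si ltnn eqxx mul0r mulr0.
Qed.

Theorem theorem31 (R : comNzRingType) (n : nat) (hn : (1 <= n)%N) :
  \sum_(s in derangements n) (-1) ^+ num_inversions s * xmon R (EXCi s) =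
  (-1) ^+ n.-1 * \sum_(1 <= j < n) \prod_(i < n | (i < j)%N) 'X_i
    :> {mpoly R[n]}.
Proof.
case: n hn => // n _.
(* The [j = 0] term of [run_sum 0] is 1 and cancels the 1 in the determinant; the remaining minus
   sign lowers the exponent of -1 by one. *)
rewrite -det_excedance_mx_derangements det_excedance_mx /run_sum big_ltn //.
rewrite [\prod_(_ < _ | (0 <= _ < 0)%N) _]big1 => [|i]; last by rewrite ltn0 andbF.
by rewrite opprD addrA subrr add0r exprS mulN1r mulrNN.
Qed.
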